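(* Let $n=2m+1$ be an odd positive integer, and let $\alpha_1,\alpha_2,\dots,\alpha_m,\alpha_{m+1}$ be pairwise different real numbers with $\alpha_i\ge 1$ for $i=1,\dots,m+1$. Define the monic polynomials of degree $n$ $$a^0(s)=(s+\alpha_{m+1})\prod_{j=1}^{m}(s^2+\alpha_j s+\alpha_j),$$ for $k=1,\dots,m$, $$a^{2k-1}(s)=(s^2+\alpha_k)(s+\alpha_{m+1})\prod_{\substack{1\le j\le m\\ j\ne k}}(s^2+\alpha_j s+\alpha_j),\qquad a^{2k}(s)=(s^2+\alpha_k s)(s+\alpha_{m+1})\prod_{\substack{1\le j\le m\\ j\ne k}}(s^2+\alpha_j s+\alpha_j),$$ and $$a^{n}(s)=s\prod_{j=1}^{m}(s^2+\alpha_j s+\alpha_j).$$ Let $a^0,a^1,\dots,a^n\in\mathbb{R}^n$ be the corresponding coefficient vectors and let $$\mathcal{P}=\mathrm{conv}\{a^0,a^1,\dots,a^n\}\subset\mathbb{R}^n .$$ Then every interior point of the polytope $\mathcal{P}$ is stable, i.e. the interior of $\mathcal{P}$ is contained in $\mathcal{H}^n$.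
   Context: A monic real polynomial $a(s)=a_1+a_2s+\dots+a_ns^{n-1}+s^n$ of degree $n$ is identified with its coefficient vector $a=(a_1,a_2,\dots,a_n)^T\in\mathbb{R}^n$ (the leading coefficient $1$ is omitted). The polynomial $a(s)$ is called (Hurwitz) stable if all of its complex roots $s_1,\dots,s_n$ satisfy $\mathrm{Re}(s_i)<0$; the corresponding vector is then called stable. The set of stable vectors is $$\mathcal{H}^n=\{a=(a_1,\dots,a_n)^T\in\mathbb{R}^n:\ a(s)\text{ is Hurwitz stable}\}.$$ $\mathrm{conv}$ denotes the convex hull, and the interior is taken in $\mathbb{R}^n$. *)

(* Defs.v *)
From HB Require Import structures.
From mathcomp Require Import all_boot all_order all_algebra.
From mathcomp Require Import complex zify.
From mathcomp Require Import all_classical all_reals all_analysis.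

Set Implicit Arguments.
Unset Strict Implicit.
Unset Printing Implicit Defensive.

Import Order.TTheory GRing.Theory Num.Theory.
Import numFieldNormedType.Exports.

Local Open Scope classical_set_scope.
Local Open Scope ring_scope.

(* [rVpoly] and [poly_rV] are little-endian, so component [i : 'I_n] of a
   vector is the coefficient of ['X^i].  The leading coefficient is dropped
   when a monic polynomial of degree [n] is turned into [poly_rV p : 'rV_n],
   and [monic_of_vec] puts it back. *)
Definition monic_of_vec (R : nzRingType) (n : nat) (a : 'rV[R]_n) : {poly R} :=
  'X^n + rVpoly a.

Lemma monic_of_vecK (R : nzRingType) (n : nat) (p : {poly R}) :
  p \is monic -> size p = n.+1 -> monic_of_vec (poly_rV p : 'rV_n) = p.
Proof.
move=> /monicP p1 sp; apply/polyP => i.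
rewrite /monic_of_vec coefD coefXn coef_rVpoly.
case: insubP => [j ltin ji|].
  by rewrite mxE ji (ltn_eqF ltin) add0r.
rewrite -leqNgt leq_eqVlt => /orP[/eqP <-|ltni].
  by rewrite eqxx addr0 -p1 lead_coefE sp.
by rewrite (gtn_eqF ltni) addr0 nth_default // sp.
Qed.

Definition hurwitz_stable (R : realType) (p : {poly R}) : Prop :=
  forall z : R[i], root (map_poly (real_complex R) p) z -> complex.Re z < 0.

Definition stable_vectors (R : realType) (n : nat) : set 'rV[R]_n :=
  [set a | hurwitz_stable (monic_of_vec a)].
Arguments stable_vectors : clear implicits.

Definition convex_hull (R : realType) (n : nat) (A : set 'rV[R]_n) :
    set 'rV[R]_n :=
  smallest (@convex_set R 'rV[R]_n) A.

Section vertex_polynomials.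
Variables (R : realType) (m : nat) (alpha : nat -> R).

Definition quad (j : nat) : {poly R} := 'X^2 + alpha j *: 'X + (alpha j)%:P.

(* Only [alpha 1], ..., [alpha m.+1] and the indices [0 <= i <= 2m+1] are
   meaningful; [uphalf i] is the [k] for which [i = 2k-1] or [i = 2k]. *)
Definition vertex_poly (i : nat) : {poly R} :=
  if i == 0 then ('X + (alpha m.+1)%:P) * \prod_(1 <= j < m.+1) quad j
  else if i == (2 * m + 1)%N then 'X * \prod_(1 <= j < m.+1) quad j
  else let k := uphalf i in
    (if odd i then 'X^2 + (alpha k)%:P else 'X^2 + alpha k *: 'X)
    * ('X + (alpha m.+1)%:P) * \prod_(1 <= j < m.+1 | j != k) quad j.

Lemma vertex_poly0 :
  vertex_poly 0 = ('X + (alpha m.+1)%:P) * \prod_(1 <= j < m.+1) quad j.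
Proof. by []. Qed.

Lemma vertex_poly_odd (k : nat) : (1 <= k <= m)%N ->
  vertex_poly (2 * k - 1) =
  ('X^2 + (alpha k)%:P) * ('X + (alpha m.+1)%:P)
  * \prod_(1 <= j < m.+1 | j != k) quad j.
Proof.
case: k => // k /= km; have -> : (2 * k.+1 - 1 = k.*2.+1)%N.
  by rewrite mul2n doubleS subn1.
rewrite /vertex_poly /= mul2n addn1 eqSS (inj_eq double_inj) (ltn_eqF km).
by rewrite odd_double doubleK.
Qed.

Lemma vertex_poly_even (k : nat) : (1 <= k <= m)%N ->
  vertex_poly (2 * k) =
  ('X^2 + alpha k *: 'X) * ('X + (alpha m.+1)%:P)
  * \prod_(1 <= j < m.+1 | j != k) quad j.
Proof.
move=> /andP[k0 km]; rewrite /vertex_poly !mul2n double_eq0 -(negbK (k == 0)).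
rewrite -lt0n k0 /= addn1 uphalf_double odd_double.
by case: eqP => // /(congr1 odd); rewrite /= !odd_double.
Qed.

Lemma vertex_poly_last :
  vertex_poly (2 * m + 1) = 'X * \prod_(1 <= j < m.+1) quad j.
Proof. by rewrite /vertex_poly addn1 /= eqxx. Qed.

Let mdeg (d : nat) (p : {poly R}) := p \is monic /\ size p = d.+1.

Let mdegM (d e : nat) (p q : {poly R}) :
  mdeg d p -> mdeg e q -> mdeg (d + e) (p * q).
Proof.
move=> [mp sp] [mq sq]; split; first by rewrite monicMl.
by rewrite size_Mmonic ?monic_neq0// sp sq addSn addnS.
Qed.

Let mdeg_lin (c : R) : mdeg 1 ('X + c%:P).
Proof.
by rewrite -(opprK c) rmorphN /=; split; rewrite ?monicXsubC ?size_XsubC.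
Qed.

Let mdeg2 (b c : R) : mdeg 2 ('X^2 + b *: 'X + c%:P).
Proof.
have sz : (size (b *: 'X + c%:P)%R < size ('X^2 : {poly R})%R)%N.
  rewrite size_polyXn (leq_ltn_trans (size_polyD _ _))// gtn_max.
  rewrite (leq_ltn_trans (size_scale_leq _ _)) ?size_polyX//=.
  by rewrite (leq_ltn_trans (size_polyC_leq1 _)).
rewrite -addrA; split; last by rewrite size_polyDl// size_polyXn.
by rewrite monicE lead_coefDl// lead_coefXn.
Qed.

Let mdeg_prod : mdeg (2 * m) (\prod_(1 <= j < m.+1) quad j).
Proof.
elim: m => [|k IH]; first by rewrite big_nil /mdeg monic1 size_poly1.
by rewrite big_nat_recr//= mulnS addnC; exact: mdegM IH (mdeg2 _ _).
Qed.

Let mdeg_prodD1 (k : nat) : (1 <= k <= m)%N ->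
  mdeg (2 * m - 2) (\prod_(1 <= j < m.+1 | j != k) quad j).
Proof.
move=> km; set p := \prod_(_ <= _ < _ | _) _.
have mp : p \is monic by apply: monic_prod => j _; exact: (mdeg2 _ _).1.
have := mdeg_prod.2; rewrite (bigD1_seq k) ?iota_uniq ?mem_index_iota//=.
rewrite -/p (size_Mmonic (monic_neq0 (mdeg2 _ _).1) mp) (mdeg2 _ _).2.
by rewrite addSn addSn /= => -[sp]; split=> //; move: (size p) sp => s; lia.
Qed.

Lemma vertex_poly_monic (i : nat) : (i <= 2 * m + 1)%N ->
  vertex_poly i \is monic /\ size (vertex_poly i) = (2 * m + 1).+1.
Proof.
move=> im; rewrite /vertex_poly; case: eqP => [_|/eqP i0].
  by rewrite [(2 * m + 1)%N]addnC; exact: mdegM (mdeg_lin _) mdeg_prod.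
case: eqP => [_|/eqP iN].
  rewrite [(2 * m + 1)%N]addnC -['X]addr0.
  exact: mdegM (mdeg_lin 0) mdeg_prod.
have km : (1 <= uphalf i <= m)%N by lia.
have -> : (2 * m + 1 = 2 + 1 + (2 * m - 2))%N by lia.
apply: mdegM (mdeg_prodD1 km); apply: mdegM (mdeg_lin _).
case: ifP => _.
  by have := mdeg2 0 (alpha (uphalf i)); rewrite scale0r addr0.
by have := mdeg2 (alpha (uphalf i)) 0; rewrite addr0.
Qed.

End vertex_polynomials.

(* Main.v *)
(* Write [p] for the polynomial of a point of the polytope and [a0] for vertex
   [0].  For each vertex polynomial [v], the ratio [v / a0] is one of
   [1], [(s^2 + c) / (s^2 + c s + c)], [(s^2 + c s) / (s^2 + c s + c)] and
   [s / (s + c)] with [c >= 1], and each of these has nonnegative real part on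
   the closed right half-plane.  Hence so has [p / a0] on the whole polytope.
   Since an interior point lies strictly between [a0] and another point of the
   polytope, there the real part of [p / a0] is even positive, so that [p] has
   no root in the closed right half-plane. *)
Require Import Defs.
From HB Require Import structures.
From mathcomp Require Import all_boot all_order all_algebra.
From mathcomp Require Import complex zify ring lra.
From mathcomp Require Import all_classical all_reals all_analysis.
Import Order.TTheory GRing.Theory Num.Theory.
Import numFieldNormedType.Exports.
Local Open Scope classical_set_scope.
Local Open Scope ring_scope.

(** The map sending [e] to [a + e *: (a - b)] is continuous and equals [a] at 0, so a short step
    from [a] away from [b] stays in [A]. *)
Lemma interior_extend (R : realType) (V : normedModType R) (A : set V)
    (a b : V) :
  interior A a -> exists2 e : R, 0 < e & A (a + e *: (a - b)).
Proof.
move=> Aa.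
have ca : {for (0 : R^o), continuous (fun e : R^o => a + e *: (a - b))}.
  apply: cvgD; first exact: cvg_cst.
  by apply: cvgZl; exact: cvg_id.
have /ca : nbhs (a + (0 : R) *: (a - b)) A by rewrite scale0r addr0.
rewrite nbhs_simpl => /nbhs_ballP[e /= e0 eA].
exists (e / 2); first by rewrite divr_gt0.
apply: eA; rewrite /ball/= sub0r normrN gtr0_norm ?divr_gt0//.
by rewrite gtr_pMr// invf_lt1// ltr1n.
Qed.

(** [monic_of_vec] is affine rather than linear; it respects convex combinations because their
    weights sum to 1, which preserves the leading term. *)
Lemma convex_monic_ge0 (R : realType) (n : nat) (f : {scalar {poly R}}) :
  convex_set [set v : 'rV[R]_n | 0 <= f (monic_of_vec v)].
Proof.
move=> x y t /set_mem/= fx /set_mem/= fy; apply/mem_set => /=.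
set r := (t%:num)%R.
have -> : monic_of_vec (conv t x y) =
          r *: monic_of_vec x + (1 - r) *: monic_of_vec y.
  rewrite /monic_of_vec (_ : conv t x y = r *: x + (1 - r) *: y :> 'rV[R]_n)//.
  rewrite linearD !linearZ/= !scalerDr addrACA -scalerDl.
  by rewrite [r + _]addrC subrK scale1r.
have [r0 r1] : 0 <= r /\ r <= 1 by rewrite /r ge0 le1.
by rewrite linearD !linearZ /= addr_ge0// mulr_ge0// subr_ge0.
Qed.

Section half_plane.
Variable R : realType.
Implicit Types (u v w z : R[i]) (p q r : {poly R}).

Let ev z p : R[i] := (map_poly (real_complex R) p).[z].

(* This is [Re (p z / q z)] times [`|q z| ^+ 2], so that it is linear in [p]. *)
Definition re_cross z q p : R := complex.Re (ev z p * (ev z q)^*%C).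

Lemma re_cross_is_scalar z q : scalar (re_cross z q).
Proof.
move=> c p1 p2; rewrite /re_cross /ev rmorphD/= map_polyZ hornerD hornerZ.
case: (_.[z]) (_.[z]) (_.[z]) => a1 b1 [a2 b2] [a3 b3] /=; ring.
Qed.

HB.instance Definition _ z q :=
  GRing.isLinear.Build R {poly R} R _ (re_cross z q) (re_cross_is_scalar z q).

Lemma Re_mulcJ_ge0 w : 0 <= complex.Re (w * w^*%C).
Proof. by case: w => a b /=; nra. Qed.

Lemma Re_mulcJ_gt0 w : w != 0 -> 0 < complex.Re (w * w^*%C).
Proof.
case: w => a b; rewrite eq_complex negb_and /= => ab0.
have : 0 < a ^+ 2 + b ^+ 2.
  case/orP: ab0 => h; first by rewrite ltr_pwDl ?sqr_ge0 ?exprn_even_gt0.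
  by rewrite ltr_wpDl ?sqr_ge0 ?exprn_even_gt0.
by nra.
Qed.

Lemma Re_mulMcJ u v w : complex.Re (u * v * (w * v)^*%C) =
  complex.Re (u * w^*%C) * complex.Re (v * v^*%C).
Proof. by case: u v w => [? ?] [? ?] [? ?] /=; ring. Qed.

(** A common factor [r] only scales the value by the squared modulus of [r] at [z], so it can be
    cancelled from the ratio. *)
Lemma re_crossMr z q p r :
  0 <= re_cross z q p -> 0 <= re_cross z (q * r) (p * r).
Proof.
rewrite /re_cross /ev !rmorphM !hornerM /=.
by move=> h; rewrite Re_mulMcJ mulr_ge0 ?Re_mulcJ_ge0.
Qed.

Lemma re_cross_id z p : 0 <= re_cross z p p.
Proof. exact: Re_mulcJ_ge0. Qed.

Let evX z : ev z 'X = z.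
Proof. by rewrite /ev map_polyX hornerX. Qed.

Let evC z c : ev z c%:P = real_complex R c.
Proof. by rewrite /ev map_polyC hornerC. Qed.

Let evD z p q : ev z (p + q) = ev z p + ev z q.
Proof. by rewrite /ev rmorphD hornerD. Qed.

Let evM z p q : ev z (p * q) = ev z p * ev z q.
Proof. by rewrite /ev rmorphM hornerM. Qed.

Let evE := (evD, evM, evX, evC, expr2, fun c p => esym (mul_polyC c p)).

Variables (z : R[i]) (c : R).
Hypotheses (z0 : 0 <= complex.Re z) (c1 : 1 <= c).

Lemma re_cross_lin : 0 <= re_cross z ('X + c%:P) 'X.
Proof.
rewrite /re_cross !evE; case: z z0 => x y /= x0.
set r := (X in 0 <= X).
have -> : r = x * (x + c) + y ^+ 2 by rewrite /r; ring.
by rewrite addr_ge0 ?sqr_ge0// mulr_ge0// addr_ge0// (le_trans ler01).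
Qed.

Lemma re_cross_quad_odd :
  0 <= re_cross z ('X^2 + c *: 'X + c%:P) ('X^2 + c%:P).
Proof.
rewrite /re_cross !evE; case: z z0 => x y /= x0.
set r := (X in 0 <= X).
(* The two squares form |z^2 + c|^2; the rest is c times the real part of z^2 + c times the
   conjugate of z. *)
have -> : r = (x ^+ 2 - y ^+ 2 + c) ^+ 2 + (2 * x * y) ^+ 2
            + c * x * (x ^+ 2 + y ^+ 2 + c) by rewrite /r; ring.
have c0 : 0 <= c by exact: le_trans ler01 c1.
by rewrite !addr_ge0 ?sqr_ge0// !mulr_ge0// !addr_ge0// sqr_ge0.
Qed.

Lemma re_cross_quad_even :
  0 <= re_cross z ('X^2 + c *: 'X + c%:P) ('X^2 + c *: 'X).
Proof.
rewrite /re_cross !evE; case: z z0 => x y /= x0.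
set r := (X in 0 <= X).
(* Here the bound [1 <= c] is essential: at x = 0 the value is y^2 (y^2 + c (c - 1)), negative for
   small nonzero y if 0 < c < 1. *)
have -> : r = x ^+ 2 * ((x + c) ^+ 2 + y ^+ 2) + c * x ^+ 2 + c ^+ 2 * x
  + y ^+ 2 * (x ^+ 2 + 2 * x * c + y ^+ 2 + c * (c - 1)) by rewrite /r; ring.
have c0 : 0 <= c by exact: le_trans ler01 c1.
have c10 : 0 <= c - 1 by rewrite subr_ge0.
by move: (c - 1) c10 => d d0; rewrite !(sqr_ge0, ler0n, addr_ge0, mulr_ge0).
Qed.

Lemma horner_lin_neq0 : ev z ('X + c%:P) != 0.
Proof.
rewrite !evE; case: z z0 => x y /= x0.
rewrite eq_complex negb_and /=; apply/orP; left.
by apply/lt0r_neq0/ltr_wpDl => //; exact: lt_le_trans ltr01 c1.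
Qed.

Lemma horner_quad_neq0 : ev z ('X^2 + c *: 'X + c%:P) != 0.
Proof.
rewrite !evE; case: z z0 => x y /= x0.
have c0 : 0 < c by exact: lt_le_trans ltr01 c1.
rewrite eq_complex /=; apply/negP => /andP[/eqP re0 /eqP im0].
(* The imaginary part forces a root with x >= 0 to be real, but on the nonnegative reals the
   quadratic is positive. *)
have : (2 * x + c) * y = 0 by rewrite -im0; ring.
move/eqP; rewrite mulf_eq0 gt_eqF/= => [/eqP y0|]; last first.
  by rewrite ltr_wpDl// mulr_ge0.
have : 0 < x ^+ 2 + c * x + c.
  by rewrite ltr_wpDl// addr_ge0 ?sqr_ge0// mulr_ge0// ltW.
by rewrite -[ltRHS]subr0 -[X in _ - X]re0 y0 (_ : _ - _ = 0) ?ltxx//; ring.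
Qed.

End half_plane.

Section vertices.
Variables (R : realType) (m : nat) (alpha : nat -> R) (z : R[i]).
Hypotheses (z0 : 0 <= complex.Re z)
  (alpha_ge1 : forall i : nat, (1 <= i <= m.+1)%N -> 1 <= alpha i).

Lemma re_cross_vertex_ge0 (i : nat) : (i <= 2 * m + 1)%N ->
  0 <= re_cross R z (vertex_poly m alpha 0) (vertex_poly m alpha i).
Proof.
move=> im; rewrite vertex_poly0 /vertex_poly; case: eqP => [_|/eqP i0].
  exact: re_cross_id.
case: eqP => [_|/eqP iN].
  by apply/re_crossMr/re_cross_lin => //; apply: alpha_ge1; rewrite ltnSn.
have km : (1 <= uphalf i <= m)%N by lia.
have /alpha_ge1 ak : (1 <= uphalf i <= m.+1)%N by lia.
(* Splitting off factor k = [uphalf i] exhibits both polynomials as a quadratic times the same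
   cofactor. *)
rewrite (bigD1_seq (uphalf i)) ?iota_uniq ?mem_index_iota//=.
rewrite [_ * (quad _ _ * _)]mulrCA -[_ * _ * \prod_(_ <= _ < _ | _) _]mulrA.
apply: re_crossMr; case: ifP => _.
  exact: re_cross_quad_odd.
exact: re_cross_quad_even.
Qed.

(** The value is the squared modulus of vertex 0 at [z], and none of its linear and quadratic
    factors vanishes there. *)
Lemma re_cross_vertex0_gt0 :
  0 < re_cross R z (vertex_poly m alpha 0) (vertex_poly m alpha 0).
Proof.
apply: Re_mulcJ_gt0; rewrite vertex_poly0 rmorphM hornerM mulf_neq0//=.
  by apply: horner_lin_neq0 => //; apply: alpha_ge1; rewrite ltnSn.
rewrite big_seq.
apply: (big_ind (fun p => (map_poly (real_complex R) p).[z] != 0)).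
- by rewrite rmorph1 hornerC oner_eq0.
- by move=> p q p0 q0; rewrite rmorphM hornerM mulf_neq0.
move=> j; rewrite mem_index_iota => jm.
by apply: horner_quad_neq0 => //; apply: alpha_ge1; lia.
Qed.

End vertices.

Theorem theorem2 (R : realType) (m n : nat) (alpha : nat -> R)
  (hn : n = (2 * m + 1)%N)
  (alpha_inj : forall i j : nat, (1 <= i <= m.+1)%N -> (1 <= j <= m.+1)%N ->
     i <> j -> alpha i <> alpha j)
  (alpha_ge1 : forall i : nat, (1 <= i <= m.+1)%N -> 1 <= alpha i) :
  interior (convex_hull [set (poly_rV (vertex_poly m alpha i) : 'rV[R]_n)
                 | i in [set i : nat | (i <= n)%N]])
  `<=` stable_vectors R n.
Proof.
subst n => a /(interior_extend _ _ _ _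
  (poly_rV (vertex_poly m alpha 0)))[e e0 Pb] z /rootP az.
rewrite ltNge; apply/negP => z0.
pose f : {scalar {poly R}} := re_cross R z (vertex_poly m alpha 0).
set b := a + _ in Pb.
have fb : 0 <= f (monic_of_vec b).
  (* The hull lies in every convex set containing the vertices, in particular in this half-space. *)
  apply: (Pb [set v | 0 <= f (monic_of_vec v)]); split.
    exact: (convex_monic_ge0 _ _ f).
  move=> _ [i /= im <-].
  have [mi si] := vertex_poly_monic alpha im.
  by rewrite monic_of_vecK//; exact: re_cross_vertex_ge0.
have [mv sv] := vertex_poly_monic (m := m) alpha (leq0n _).
(* The weights [1 + e] and [- e] sum to 1, so the relation between vectors lifts to the monic
   polynomials. *)
have ab : monic_of_vec b =
    (1 + e) *: monic_of_vec a - e *: vertex_poly m alpha 0.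
  rewrite -(monic_of_vecK mv sv) /monic_of_vec /b linearD linearZ linearB /=.
  by rewrite scalerBr !scalerDl !scale1r -!mul_polyC; ring.
(* A root at [z] makes [f] vanish at [a], so at [b] its value is [- e] times its positive value at
   vertex 0, contradicting [fb]. *)
have fa : f (monic_of_vec a) = 0 by rewrite /f /= /re_cross az mul0r.
move: fb; rewrite ab linearB !linearZ /= fa mulr0 add0r.
rewrite -[e *: _]/(e * _) mulrN oppr_ge0 leNgt.
by rewrite mulr_gt0// re_cross_vertex0_gt0.
Qed.
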